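(* Let $n\ge2$, let $V$ be a $4n$-dimensional real vector space with a scalar product $g$, let $\mathfrak{G}$ be a para-quaternionic structure on $V$ hermitian with respect to $g$, and let $\mathfrak{H}=(J_1,J_2,J_3)$ be a corresponding para-hypercomplex structure. (i) Any curvature tensor $R\in\mathcal{R}(\mathrm{sp}(\mathfrak{G}))$ is Einstein, i.e. $$Ric(R)=\frac{K(R)}{4n}\,g,$$ where $K(R)$ is the scalar curvature of $R$. (ii) $\mathcal{R}(\mathrm{sp}(\mathfrak{G}))=\mathbb{R}\,R_{\tilde{\mathbb{H}}P^n}+\mathcal{R}(\mathrm{sp}(\mathfrak{H}))$, where $\mathcal{R}(\mathrm{sp}(\mathfrak{H}))\subset\mathcal{W}$ is an irreducible submodule and $R_{\tilde{\mathbb{H}}P^n}$ is the curvature tensor of the para-quaternionic projective space.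
   Context: Put $\epsilon_1=1$, $\epsilon_2=\epsilon_3=-1$. A para-hypercomplex structure on $V$ is a triple $(J_1,J_2,J_3)$ of endomorphisms with $J_\alpha^2=-\epsilon_\alpha\mathrm{Id}$ and $J_\beta J_\gamma=-\epsilon_\alpha J_\alpha$ for every cyclic permutation $(\alpha,\beta,\gamma)$ of $(1,2,3)$. A para-quaternionic structure is a (Lie) subalgebra $\mathfrak{G}\subset\mathrm{End}(V)$ having such a triple as a basis (the two then correspond to each other); it is hermitian with respect to $g$ if $J_1,J_2,J_3$ are $g$-skew-symmetric (then $g$ has signature $(2n,2n)$). $\mathrm{aut}(\mathfrak{G})$ and $\mathrm{aut}(\mathfrak{H})$ are the normalizer and centralizer of $\mathfrak{G}$ in $\mathrm{End}(V)$; $\mathrm{sp}(\mathfrak{G})$ and $\mathrm{sp}(\mathfrak{H})$ are their subalgebras of $g$-skew-symmetric endomorphisms. For a Lie subalgebra $\mathcal{L}\subset\mathrm{End}(V)$, $\mathcal{R}(\mathcal{L})$ is the space of $\mathcal{L}$-valued 2-forms $R$ on $V$ satisfying the Bianchi identity $R(X,Y)Z+R(Y,Z)X+R(Z,X)Y=0$; it is naturally an $\mathcal{L}$-module. $Ric(R)(Y,Z)=\mathrm{Tr}(X\mapsto R(X,Y)Z)$, $K(R)$ is the $g$-trace of $Ric(R)$, and $\mathcal{W}$ is the kernel of $Ric$ on $\mathcal{R}(\mathrm{aut}(\mathfrak{G}))$. The tensor $R_{\tilde{\mathbb{H}}P^n}$ is $$R_{\tilde{\mathbb{H}}P^n}(A,B)C=g(B,C)A-g(A,C)B+\sum_{\alpha=1}^3\epsilon_\alpha\bigl(g(J_\alpha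 B,C)J_\alpha A-g(J_\alpha A,C)J_\alpha B\bigr)-2\sum_{\alpha=1}^3\epsilon_\alpha g(J_\alpha A,B)J_\alpha C.$$ *)

(* Defs.v *)
From HB Require Import structures.
From mathcomp Require Import all_boot all_order all_algebra.
From mathcomp Require Import classical_sets reals.
Set Implicit Arguments.
Unset Strict Implicit.
Unset Printing Implicit Defensive.
Import Order.TTheory GRing.Theory Num.Theory.
Local Open Scope classical_set_scope.
Local Open Scope ring_scope.

Section Endomorphisms.
Variables (R : realType) (V : vectType R).

Definition bracket (A B : 'End(V)) : 'End(V) := (A \o B)%VF - (B \o A)%VF.

Definition skew (g : {symmetric V}) (A : 'End(V)) : Prop :=
  forall X Y : V, g (A X) Y = - g X (A Y).

Definition normalizer (G : {vspace 'End(V)}) : set 'End(V) :=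
  [set A | forall B, B \in G -> bracket A B \in G].

Definition centralizer (G : {vspace 'End(V)}) : set 'End(V) :=
  [set A | forall B, B \in G -> bracket A B = 0].

(* Trace of a map V -> V, which is linear wherever this is used. *)
Definition trace (f : V -> V) : R :=
  \sum_(i < \dim {:V}) coord (vbasis {:V}) i (f (vbasis {:V})`_i).

Definition gram (b : V -> V -> R) : 'M[R]_(\dim {:V}) :=
  \matrix_(i, j) b (vbasis {:V})`_i (vbasis {:V})`_j.

(* In coordinates, \sum_(i, j) g^{ij} b_{ji}. *)
Definition gtrace (g : {symmetric V}) (b : V -> V -> R) : R :=
  \tr (invmx (gram g) *m gram b).

End Endomorphisms.

Section ParaQuaternionic.
Variables (R : realType) (V : vectType R).

(* Indices 1, 2, 3 are shifted to 0, 1, 2, so that the cyclic permutations of *)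
(* (1, 2, 3) are the triples (a, a + 1, a + 2) in 'I_3 = Z/3.                 *)
Definition eps (a : 'I_3) : R := if a == 0 then 1 else -1.

Definition para_hypercomplex (J : 'I_3 -> 'End(V)) : Prop :=
  (forall a, (J a \o J a)%VF = - eps a *: \1%VF) /\
  (forall a, (J (a + 1)%R \o J (a + 2%:R)%R)%VF = - eps a *: J a).

Definition corresponding (G : {vspace 'End(V)}) (J : 'I_3 -> 'End(V)) : Prop :=
  para_hypercomplex J /\ basis_of G [seq J a | a : 'I_3].

Definition lie_subalgebra (G : {vspace 'End(V)}) : Prop :=
  forall A B, A \in G -> B \in G -> bracket A B \in G.

Definition para_quaternionic (G : {vspace 'End(V)}) : Prop :=
  lie_subalgebra G /\ exists J, corresponding G J.

Definition hermitian_for (g : {symmetric V}) (G : {vspace 'End(V)}) : Prop :=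
  exists J, corresponding G J /\ forall a, skew g (J a).

Definition autG (G : {vspace 'End(V)}) : set 'End(V) := normalizer G.
Definition autH (G : {vspace 'End(V)}) : set 'End(V) := centralizer G.
Definition spG (g : {symmetric V}) (G : {vspace 'End(V)}) : set 'End(V) :=
  autG G `&` skew g.
Definition spH (g : {symmetric V}) (G : {vspace 'End(V)}) : set 'End(V) :=
  autH G `&` skew g.

End ParaQuaternionic.

Section Curvature.
Variables (R : realType) (V : vectType R).

Local Notation bilEnd := 'Hom(V, 'Hom(V, 'End(V))).
Implicit Types (S T : bilEnd) (L : set 'End(V)) (M N U : set bilEnd).

Definition curvature L : set bilEnd :=
  [set T : bilEnd | [/\ forall X, T X X = 0,
               forall X Y, L (T X Y) &
               forall X Y Z, T X Y Z + T Y Z X + T Z X Y = 0]].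

Definition Ric T (Y Z : V) : R := trace (fun X => T X Y Z).

Definition scal (g : {symmetric V}) T : R := gtrace g (Ric T).

Definition Weyl (G : {vspace 'End(V)}) : set bilEnd :=
  curvature (autG G) `&` [set T : bilEnd | forall Y Z, Ric T Y Z = 0].

Definition act (A : 'End(V)) T : bilEnd :=
  linfun (fun X => linfun (fun Y =>
    bracket A (T X Y) - T (A X) Y - T X (A Y))).

Definition submodule L M N : Prop :=
  [/\ N `<=` M, N 0,
      forall (a : R) S T, N S -> N T -> N (a *: S + T) &
      forall A T, L A -> N T -> N (act A T)].

Definition irreducible_submodule L M N : Prop :=
  [/\ submodule L M N, exists2 T, N T & T != 0 &
      forall U, submodule L N U -> U = [set 0] \/ U = N].

Definition R_HP (g : {symmetric V}) (J : 'I_3 -> 'End(V)) : bilEnd :=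
  linfun (fun A => linfun (fun B => linfun (fun C =>
    g B C *: A - g A C *: B
    + \sum_(a < 3) eps R a *:
        (g (J a B) C *: J a A - g (J a A) C *: J a B)
    - 2%:R *: \sum_(a < 3) (eps R a * g (J a A) B) *: J a C))).

(* linfun is the identity only on linear maps: the lemmas below check that    *)
(* act and R_HP have the intended values.                                     *)

Lemma linfunE (aT rT : vectType R) (f : aT -> rT) :
  linear f -> linfun f =1 f.
Proof.
move=> lf; pose h := HB.pack_for {linear aT -> rT} f
  (GRing.isLinear.Build R aT rT *:%R f lf).
exact: (lfunE h).
Qed.

Let linD (W W' : vectType R) (f h : W -> W') :
  linear f -> linear h -> linear (fun x => f x + h x).
Proof. by move=> lf lh c x y; rewrite lf lh scalerDr addrACA. Qed.

Let linZ (W W' : vectType R) (k : R) (f : W -> W') :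
  linear f -> linear (fun x => k *: f x).
Proof. by move=> lf c x y; rewrite lf scalerDr !scalerA mulrC. Qed.

Let linN (W W' : vectType R) (f : W -> W') :
  linear f -> linear (fun x => - f x).
Proof. by move=> lf c x y; rewrite lf opprD scalerN. Qed.

Let linS (W W' : vectType R) (f : 'I_3 -> W -> W') :
  (forall a, linear (f a)) -> linear (fun x => \sum_a f a x).
Proof.
move=> lf c x y; rewrite scaler_sumr -big_split /=.
by apply: eq_bigr => a _; rewrite lf.
Qed.

Let linV (W W' : vectType R) (f : W -> R) (v : W') :
  scalar f -> linear (fun x => f x *: v).
Proof. by move=> lf c x y; rewrite lf scalerDl scalerA. Qed.

Let linL (W : vectType R) (f : 'Hom(V, W)) : linear f.
Proof. by move=> c x y; rewrite linearP. Qed.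

Let linI : linear (@id V). Proof. by []. Qed.

Let scaM (f : V -> R) (k : R) : scalar f -> scalar (fun x => k * f x).
Proof. by move=> lf c x y; rewrite lf mulrDr mulrCA. Qed.

Let gPr (g : {symmetric V}) (u : V) : scalar (g u).
Proof. by move=> c x y; rewrite linearPr. Qed.

Let gPl (g : {symmetric V}) (u : V) : scalar (fun x => g x u).
Proof. by move=> c x y; rewrite linearPl. Qed.

Let gPJr (g : {symmetric V}) (A : 'End(V)) (u : V) : scalar (fun x => g u (A x)).
Proof. by move=> c x y; rewrite linearP linearPr. Qed.

Let gPJl (g : {symmetric V}) (A : 'End(V)) (u : V) : scalar (fun x => g (A x) u).
Proof. by move=> c x y; rewrite linearP linearPl. Qed.

Let linbr (W : vectType R) A (f : W -> 'End(V)) :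
  linear f -> linear (fun x => bracket A (f x)).
Proof.
move=> lf c x y; rewrite lf /bracket comp_lfunDr comp_lfunDl.
by rewrite -comp_lfunZr -comp_lfunZl scalerBr opprD addrACA.
Qed.

Let linE (W : vectType R) (f : 'Hom(V, 'Hom(V, W))) (X : V) :
  linear (fun Z => f Z X).
Proof. by move=> c x y; rewrite linearP /= add_lfunE scale_lfunE. Qed.

Let linC (W : vectType R) (f : V -> W) (A : 'End(V)) :
  linear f -> linear (fun Z => f (A Z)).
Proof. by move=> lf c x y; rewrite linearP lf. Qed.

Lemma actE A T X Y :
  act A T X Y = bracket A (T X Y) - T (A X) Y - T X (A Y).
Proof.
have lY X' : linear (fun Y' => bracket A (T X' Y') - T (A X') Y' - T X' (A Y')).
  do 2?[apply: linD]; first exact/linbr/linL; apply: linN; first exact: linL.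
  exact/linC/linL.
have lX Y' : linear (fun X' => bracket A (T X' Y') - T (A X') Y' - T X' (A Y')).
  do 2?[apply: linD]; first exact/linbr/linE; apply: linN; last exact: linE.
  exact: (linC A (@linE _ T Y')).
rewrite /act linfunE; first by rewrite linfunE.
move=> c x y; apply/lfunP => Y'; rewrite add_lfunE scale_lfunE !linfunE //.
exact: (lX Y' c x y).
Qed.

Lemma R_HPE (g : {symmetric V}) (J : 'I_3 -> 'End(V)) A B C :
  R_HP g J A B C =
    g B C *: A - g A C *: B
    + \sum_(a < 3) eps R a *:
        (g (J a B) C *: J a A - g (J a A) C *: J a B)
    - 2%:R *: \sum_(a < 3) (eps R a * g (J a A) B) *: J a C.
Proof.
have lC A' B' : linear (fun C' : V =>
    g B' C' *: A' - g A' C' *: B'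
    + \sum_(a < 3) eps R a *:
        (g (J a B') C' *: J a A' - g (J a A') C' *: J a B')
    - 2%:R *: \sum_(a < 3) (eps R a * g (J a A') B') *: J a C').
  do 2?[apply: linD].
  - by apply: linD; [|apply: linN]; apply: linV; exact: gPr.
  - apply: linS => a; apply: linZ.
    by apply: linD; [|apply: linN]; apply: linV; exact: gPr.
  - by apply/linN/linZ/linS => a; apply/linZ/linL.
have lB A' C' : linear (fun B' : V =>
    g B' C' *: A' - g A' C' *: B'
    + \sum_(a < 3) eps R a *:
        (g (J a B') C' *: J a A' - g (J a A') C' *: J a B')
    - 2%:R *: \sum_(a < 3) (eps R a * g (J a A') B') *: J a C').
  do 2?[apply: linD].
  - apply: linD; first by apply: linV; exact: gPl.
    by apply/linN/linZ/linI.
  - apply: linS => a; apply: linZ; apply: linD.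
      by apply: linV; exact: gPJl.
    by apply/linN/linZ/linL.
  - apply/linN/linZ/linS => a; apply: linV; apply: scaM; exact: gPr.
have lA B' C' : linear (fun A' : V =>
    g B' C' *: A' - g A' C' *: B'
    + \sum_(a < 3) eps R a *:
        (g (J a B') C' *: J a A' - g (J a A') C' *: J a B')
    - 2%:R *: \sum_(a < 3) (eps R a * g (J a A') B') *: J a C').
  do 2?[apply: linD].
  - apply: linD; first by apply/linZ/linI.
    by apply: linN; apply: linV; exact: gPl.
  - apply: linS => a; apply: linZ; apply: linD; first by apply/linZ/linL.
    by apply: linN; apply: linV; exact: gPJl.
  - apply/linN/linZ/linS => a; apply: linV; apply: scaM; exact: gPJl.
have lBh A' : linear (fun B' : V => linfun (fun C' : V =>
    g B' C' *: A' - g A' C' *: B'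
    + \sum_(a < 3) eps R a *:
        (g (J a B') C' *: J a A' - g (J a A') C' *: J a B')
    - 2%:R *: \sum_(a < 3) (eps R a * g (J a A') B') *: J a C')).
  move=> c x y; apply/lfunP => C'.
  rewrite add_lfunE scale_lfunE !linfunE //; exact: (lB A' C' c x y).
rewrite /R_HP linfunE; first by rewrite linfunE // linfunE.
move=> c x y; apply/lfunP => B'; rewrite add_lfunE scale_lfunE !linfunE //.
apply/lfunP => C'; rewrite add_lfunE scale_lfunE !linfunE //.
exact: (lA B' C' c x y).
Qed.

End Curvature.

(* Main.v *)
From HB Require Import structures.
Require Import Defs.
From mathcomp Require Import all_boot all_order all_algebra.
From mathcomp Require Import boolp classical_sets reals.
From mathcomp Require Import ring lra.
Import Order.TTheory GRing.Theory Num.Theory.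
Local Open Scope classical_set_scope.
Local Open Scope ring_scope.
Set Implicit Arguments.
Unset Strict Implicit.
Unset Printing Implicit Defensive.

(* Write t(X,Y,Z,W) = g(R(X,Y)Z,W), which is symmetric under exchange of the pairs.    *)
(* Einstein: let k_a be the value of the curvature operator on the bivector dual to    *)
(* g(J_a -, -) and rho the Ricci operator. Pair symmetry turns the sp(1)-components    *)
(* of R(X,Y) into the forms g(k_a X, Y), and the contracted Bianchi identity becomes   *)
(* a linear system relating the J_a k_a and rho. For n > 1 it forces k_a = - J_a P     *)
(* with the same P, proportional to rho, for all a. As rho is symmetric and the k_a    *)
(* are skew, P commutes with the J_a; as k_1 normalizes G, P is then a scalar. Hence   *)
(* R is Einstein and its sp(1)-part is that of a multiple of the projective tensor.    *)
(*                                                                                     *)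
(* Irreducibility: let E be the + 1 eigenspace of J_2, with the symplectic form        *)
(* g(J_1 x, y). A tensor in R(sp(H)) is the same as the symmetric quartic form         *)
(* g(R(x, J_1 y)z, J_1 u) on E. If this form does not vanish at (e,e,e,e), applying    *)
(* four times the rank one element of sp(E) defined by e turns it into a nonzero       *)
(* multiple of the fourth power of the linear form of e. So a nonzero submodule        *)
(* contains one such power, hence all of them, and these span by polarization.         *)

(** For tensors with values in the normalizer of [G] one scalar [mu] controls everything:
    [curv_op_scalar] gives k_a = - mu J_a, and [curvature_scalar] deduces from it the Ricci tensor,
    the traces of J_a T(X,Y) and the brackets of T(X,Y) with the J_a. These brackets are those of
    the projective tensor up to a factor, so subtracting mu/(8n) times [R_HP] leaves values in
    sp(H); this is the decomposition ([curvature_spG_scalar]). If T already has values in sp(H), the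
    traces vanish, hence mu = 0 and T is Ricci flat ([curvature_spH_Weyl]).

    Irreducibility needs only the action of rank one elements of sp(H). A tensor is determined by
    its quartic form on the diagonal ([quartic_eq0]), a nonzero submodule contains every fourth
    power ([act4_veronese], [submodule_veronese]), and these powers span ([quartic_waring]). *)

Section LinearMaps.
Variables (R : realType) (U W : vectType R) (f : 'Hom(U, W)).

Lemma lfun0 : f 0 = 0. Proof. exact: linear0. Qed.
Lemma lfunD x y : f (x + y) = f x + f y. Proof. exact: linearD. Qed.
Lemma lfunN x : f (- x) = - f x. Proof. exact: linearN. Qed.
Lemma lfunZ c x : f (c *: x) = c *: f x. Proof. exact: linearZ. Qed.
Lemma lfun_sum I (r : seq I) (P : pred I) (F : I -> U) :
  f (\sum_(i <- r | P i) F i) = \sum_(i <- r | P i) f (F i).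
Proof. exact: linear_sum. Qed.

End LinearMaps.

(** * Dual bases and traces for a nondegenerate symmetric form *)

Section Form.
Variables (R : realType) (V : vectType R) (g : {symmetric V}).
Hypothesis g_nondeg : nondegenerate g.

Implicit Types (X Y Z W : V) (A B : 'End(V)).

Lemma formC X Y : g X Y = g Y X.
Proof. by rewrite [LHS]hermC expr0 mul1r. Qed.

Lemma formDl X Y Z : g (X + Y) Z = g X Z + g Y Z.
Proof. exact: linearDl. Qed.

Lemma formDr X Y Z : g Z (X + Y) = g Z X + g Z Y.
Proof. exact: linearDr. Qed.

Lemma formNl X Z : g (- X) Z = - g X Z.
Proof. exact: linearNl. Qed.

Lemma formNr X Z : g Z (- X) = - g Z X.
Proof. exact: linearNr. Qed.

Lemma formZl c X Z : g (c *: X) Z = c * g X Z.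
Proof. exact: linearZl_LR. Qed.

Lemma formZr c X Z : g Z (c *: X) = c * g Z X.
Proof. exact: linearZr_LR. Qed.

Lemma form0l Z : g 0 Z = 0.
Proof. exact: linear0l. Qed.

Lemma form0r Z : g Z 0 = 0.
Proof. exact: linear0r. Qed.

Lemma form_suml I (r : seq I) (P : pred I) (F : I -> V) Z :
  g (\sum_(i <- r | P i) F i) Z = \sum_(i <- r | P i) g (F i) Z.
Proof. exact: linear_sumlz. Qed.

Lemma form_sumr I (r : seq I) (P : pred I) (F : I -> V) Z :
  g Z (\sum_(i <- r | P i) F i) = \sum_(i <- r | P i) g Z (F i).
Proof. exact: linear_sumr. Qed.

Definition formE := (formDl, formDr, formNl, formNr, formZl, formZr, form0l,
  form0r, form_suml, form_sumr).

Lemma form_eq0 X : (forall W, g X W = 0) -> X = 0.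
Proof.
move=> X0; apply/eqP; rewrite -memv0 -(eqP g_nondeg).
by rewrite -[_ \in _]/(<[X]> <= _)%VS -memvE; apply/orthovP => u v /vlineP[c ->] _;
   rewrite formE X0 mulr0.
Qed.

Lemma form_inj X Y : (forall W, g X W = g Y W) -> X = Y.
Proof.
move=> XY; apply/eqP; rewrite -subr_eq0; apply/eqP/form_eq0 => W.
by rewrite !formE XY subrr.
Qed.

Lemma form_neq0 X : X != 0 -> exists W, g X W != 0.
Proof.
move=> /eqP X0; apply: contrapT => nW; apply: X0; apply: form_eq0 => W.
by apply/eqP/negPn/negP => XW; apply: nW; exists W.
Qed.

Local Notation v i := ((vbasis {:V})`_(i : 'I_(\dim {:V}))).

Lemma gram_unit : gram g \in unitmx.
Proof.
rewrite -row_free_unit -kermx_eq0; apply/eqP/row_matrixP => i.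
rewrite row0; set u := row i _.
have uG : u *m gram g = 0 by rewrite -row_mul mulmx_ker row0.
pose X := \sum_k u 0 k *: v k.
have X0 : X = 0.
  apply: form_eq0 => W; rewrite (coord_vbasis (memvf W)) form_sumr big1 // => j _.
  have uGj : \sum_k u 0 k * g (v k) (v j) = 0.
    transitivity ((u *m gram g) 0 j); last by rewrite uG mxE.
    by rewrite mxE; apply: eq_bigr => k _; rewrite [gram g _ _]mxE.
  rewrite formZr form_suml; under eq_bigr do rewrite formZl.
  by rewrite uGj mulr0.
have /freeP fr := basis_free (vbasisP {:V}).
by apply/rowP => k; rewrite (fr (fun k => u 0 k) X0) mxE.
Qed.

(** Contracting a basis with its g-dual computes traces in any signature, without sign
    bookkeeping. *)
Definition dual_vbasis (i : 'I_(\dim {:V})) : V :=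
  \sum_j invmx (gram g) i j *: v j.
Local Notation d := dual_vbasis.

Lemma form_dual (i j : 'I_(\dim {:V})) : g (d i) (v j) = (i == j)%:R.
Proof.
rewrite form_suml; under eq_bigr do rewrite formZl.
have /matrixP/(_ i j) := mulVmx gram_unit.
by rewrite !mxE => <-; apply: eq_bigr => k _; rewrite !mxE.
Qed.

Lemma form_coord i X : g (d i) X = coord (vbasis {:V}) i X.
Proof.
rewrite {1}(coord_vbasis (memvf X)) form_sumr (bigD1 i) //= big1 => [|j ji].
  by rewrite formZr form_dual eqxx mulr1 addr0.
by rewrite formZr form_dual eq_sym (negPf ji) mulr0.
Qed.

Lemma dual_decomp X : X = \sum_i g (d i) X *: v i.
Proof.
by rewrite {1}(coord_vbasis (memvf X)); apply: eq_bigr => i _; rewrite form_coord.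
Qed.

Lemma vbasis_decomp X : X = \sum_i g (v i) X *: d i.
Proof.
apply: form_inj => W; rewrite {1}(dual_decomp W) form_sumr form_suml.
by apply: eq_bigr => i _; rewrite formZr formZl mulrC [g X _]formC.
Qed.

Lemma traceE f : trace f = \sum_i g (d i) (f (v i)).
Proof. by apply: eq_bigr => i _; rewrite form_coord. Qed.

Lemma trace_mulC A B : trace (fun X => A (B X)) = trace (fun X => B (A X)).
Proof.
have E (C D : 'End(V)) : trace (fun X => C (D X))
    = \sum_i \sum_k g (d k) (D (v i)) * g (d i) (C (v k)).
  rewrite traceE; apply: eq_bigr => i _ /=.
  rewrite [D _ in LHS]dual_decomp linear_sum form_sumr.
  by apply: eq_bigr => k _; rewrite linearZ formZr.
rewrite !E exchange_big; apply: eq_bigr => i _; apply: eq_bigr => k _.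
exact: mulrC.
Qed.

Lemma traceD f h : trace (fun X => f X + h X) = trace f + trace h.
Proof. by rewrite !traceE -big_split; apply: eq_bigr => i _; rewrite formDr. Qed.

Lemma traceZ c f : trace (fun X => c *: f X) = c * trace f.
Proof. by rewrite !traceE mulr_sumr; apply: eq_bigr => i _; rewrite formZr. Qed.

Lemma traceN f : trace (fun X => - f X) = - trace f.
Proof. by rewrite !traceE -sumrN; apply: eq_bigr => i _; rewrite formNr. Qed.

Lemma trace_id : trace (@id V) = (\dim {:V})%:R.
Proof.
rewrite traceE (eq_bigr (fun=> 1)) => [|i _]; last by rewrite form_dual eqxx.
by rewrite sumr_const card_ord.
Qed.

(* sum_i v^i (x) v_i is the tensor of the identity map, so endomorphisms can be moved  *)
(* from one factor to the other by taking adjoints, and the factors can be exchanged.   *)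
Lemma sum_dual_skew (W : vectType R) (F : V -> V -> W) A : Defs.skew g A ->
    (forall Y, linear (F^~ Y)) -> (forall X, linear (F X)) ->
  \sum_i F (A (d i)) (v i) = - \sum_i F (d i) (A (v i)).
Proof.
move=> skA linl linr.
pose Fl Y : {linear V -> W} := HB.pack (F^~ Y)
  (GRing.isLinear.Build R V W *:%R (F^~ Y) (linl Y)).
pose Fr X : {linear V -> W} := HB.pack (F X)
  (GRing.isLinear.Build R V W *:%R (F X) (linr X)).
transitivity (\sum_i \sum_k - g (d i) (A (v k)) *: F (d k) (v i)).
  apply: eq_bigr => i _; rewrite [A _ in LHS]vbasis_decomp.
  rewrite -[F _ _]/(Fl (v i) _) linear_sum; apply: eq_bigr => k _.
  by rewrite linearZ formC skA.
rewrite exchange_big -sumrN; apply: eq_bigr => k _.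
rewrite [A _ in RHS]dual_decomp -[F (d k) _]/(Fr (d k) _) linear_sum -sumrN.
by apply: eq_bigr => i _; rewrite linearZ scaleNr.
Qed.

Lemma sum_dualC (W : vectType R) (F : V -> V -> W) :
    (forall Y, linear (F^~ Y)) -> (forall X, linear (F X)) ->
  \sum_i F (d i) (v i) = \sum_i F (v i) (d i).
Proof.
move=> linl linr.
pose Fl Y : {linear V -> W} := HB.pack (F^~ Y)
  (GRing.isLinear.Build R V W *:%R (F^~ Y) (linl Y)).
pose Fr X : {linear V -> W} := HB.pack (F X)
  (GRing.isLinear.Build R V W *:%R (F X) (linr X)).
transitivity (\sum_i \sum_k g (d i) (d k) *: F (v k) (v i)).
  apply: eq_bigr => i _; rewrite [d i in LHS]dual_decomp.
  rewrite -[F _ _]/(Fl (v i) _) linear_sum; apply: eq_bigr => k _.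
  by rewrite linearZ formC.
rewrite exchange_big; apply: eq_bigr => k _.
rewrite [d k in RHS]dual_decomp -[F (v k) _]/(Fr (v k) _) linear_sum.
by apply: eq_bigr => i _; rewrite linearZ.
Qed.

(** Exchanging the factors of the identity tensor and then using skewness negates the trace. *)
Lemma trace_skew A : Defs.skew g A -> trace A = 0.
Proof.
move=> skA; suff : trace A = - trace A by lra.
rewrite traceE {1}(@sum_dualC R^o (fun X Y => g X (A Y))) => [|Y c X Z|X c Y Z].
- by rewrite -sumrN; apply: eq_bigr => i _; rewrite -skA formC.
- exact: linearPl.
- by rewrite linearP; exact: linearPr.
Qed.

Lemma gtraceZ c : gtrace g (fun X Y => c * g X Y) = c * (\dim {:V})%:R.
Proof.
rewrite /gtrace; have -> : gram (fun X Y => c * g X Y) = c *: gram g.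
  by apply/matrixP => i j; rewrite !mxE.
by rewrite -scalemxAr mulVmx ?gram_unit // mxtraceZ mxtrace1.
Qed.

End Form.

(** * Brackets and pair symmetry *)

Section Endomorphisms.
Variables (R : realType) (V : vectType R) (g : {symmetric V}).

Lemma bracketE (A B : 'End(V)) x : bracket A B x = A (B x) - B (A x).
Proof. by rewrite add_lfunE opp_lfunE !comp_lfunE. Qed.

Lemma eq_trace (f h : V -> V) : f =1 h -> trace f = trace h.
Proof. by move=> fh; apply: eq_bigr => i _; rewrite fh. Qed.

Lemma skew_self (A : 'End(V)) x : Defs.skew g A -> g (A x) x = 0.
Proof. by move=> skA; have := skA x x; rewrite [g x _]formC; lra. Qed.

(** The Bianchi identities for the four cyclic rotations of x, y, z, w combine, through the two
    antisymmetries, into the claim. *)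
Lemma pair_symmetry (T : Type) (t : T -> T -> T -> T -> R) :
    (forall x y z w, t x y z w = - t y x z w) ->
    (forall x y z w, t x y z w = - t x y w z) ->
    (forall x y z w, t x y z w + t y z x w + t z x y w = 0) ->
  forall x y z w, t x y z w = t z w x y.
Proof.
move=> t12 t34 tB x y z w.
have := tB x y z w; have := tB y z w x; have := tB z w x y; have := tB w x y z.
have := t34 y z w x; have := t34 z w y x; have := t12 w y z x.
have := t12 w x z y; have := t34 x w z y; have := t12 x z w y.
have := t34 z x w y; have := t12 w x y z; have := t34 x y w z.
by have := t34 y w x z; lra.
Qed.

End Endomorphisms.

(** * Para-quaternion algebra and the trace form on [G] *)

Lemma ord3_ind (P : 'I_3 -> Prop) : P 0 -> P 1 -> P 2%:R -> forall a, P a.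
Proof.
move=> P0 P1 P2 [[|[|[|//]]] a3].
- by rewrite (_ : Ordinal a3 = 0) //; exact: val_inj.
- by rewrite (_ : Ordinal a3 = 1) //; exact: val_inj.
- by rewrite (_ : Ordinal a3 = 2%:R) //; exact: val_inj.
Qed.

Lemma sum_ord3 (W : nmodType) (F : 'I_3 -> W) : \sum_a F a = F 0 + F 1 + F 2%:R.
Proof.
rewrite !big_ord_recl big_ord0 addr0 addrA.
by congr (F _ + F _ + F _); exact: val_inj.
Qed.

Lemma eps0 (R : realType) : eps R 0 = 1. Proof. by []. Qed.
Lemma eps1 (R : realType) : eps R 1 = -1. Proof. by []. Qed.
Lemma eps2 (R : realType) : eps R 2%:R = -1. Proof. by []. Qed.

Section ParaHypercomplex.
Variables (R : realType) (V : vectType R) (J : 'I_3 -> 'End(V)).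
Hypothesis Jpara : para_hypercomplex J.

Local Notation J1 := (J 0).
Local Notation J2 := (J 1).
Local Notation J3 := (J 2%:R).

Let sqJ a x : J a (J a x) = - eps R a *: x.
Proof. by rewrite -comp_lfunE Jpara.1 scale_lfunE id_lfunE. Qed.

Let mulJ a b c x : b = a + 1 -> c = a + 2%:R -> J b (J c x) = - eps R a *: J a x.
Proof. by move=> -> ->; rewrite -comp_lfunE Jpara.2 scale_lfunE. Qed.

Lemma J11 x : J1 (J1 x) = - x. Proof. by rewrite sqJ scaleN1r. Qed.
Lemma J22 x : J2 (J2 x) = x. Proof. by rewrite sqJ opprK scale1r. Qed.
Lemma J33 x : J3 (J3 x) = x. Proof. by rewrite sqJ opprK scale1r. Qed.
Lemma J23 x : J2 (J3 x) = - J1 x.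
Proof. by rewrite (@mulJ 0) ?scaleN1r //; exact: val_inj. Qed.
Lemma J31 x : J3 (J1 x) = J2 x.
Proof. by rewrite (@mulJ 1) ?opprK ?scale1r //; exact: val_inj. Qed.
Lemma J12 x : J1 (J2 x) = J3 x.
Proof. by rewrite (@mulJ 2%:R) ?opprK ?scale1r //; exact: val_inj. Qed.
Lemma J32 x : J3 (J2 x) = J1 x.
Proof. by rewrite -[J2 x]J31 J33. Qed.
Lemma J21 x : J2 (J1 x) = - J3 x.
Proof. by have /(congr1 J2) := J23 x; rewrite J22 linearN => ->; rewrite opprK. Qed.
Lemma J13 x : J1 (J3 x) = - J2 x.
Proof. by rewrite -J12 J11. Qed.

Definition para_mulE := (J11, J22, J33, J12, J21, J23, J32, J31, J13).

Variable G : {vspace 'End(V)}.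
Hypothesis GJ : basis_of G [seq J a | a : 'I_3].

Lemma mem_J a : J a \in G.
Proof. by rewrite -(span_basis GJ) memv_span // map_f // mem_enum. Qed.

Lemma span_J B : B \in G ->
  exists b : 'I_3 -> R, forall x, B x = b 0 *: J1 x + b 1 *: J2 x + b 2%:R *: J3 x.
Proof.
rewrite -(span_basis GJ) span_def big_map big_enum /= => /memv_sumP[B_ BJ ->].
have /choice[b Bb] a : exists c, B_ a = c *: J a.
  by have /vlineP[c ->] := BJ a isT; exists c.
by exists b => x; rewrite sum_lfunE sum_ord3 !Bb !scale_lfunE.
Qed.

Variable g : {symmetric V}.
Hypothesis g_nondeg : nondegenerate g.
Hypothesis Jskew : forall a, Defs.skew g (J a).
Variable n : nat.
Hypothesis dimV : \dim {:V} = (4 * n)%N.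
Hypothesis n_gt1 : (2 <= n)%N.

Let trJ a A := trace (fun x => J a (A x)).

Lemma trace_J a : trace (J a) = 0.
Proof. exact: (trace_skew g_nondeg). Qed.

Let n0 : n%:R != 0 :> R.
Proof. by rewrite pnatr_eq0 -lt0n ltnW. Qed.

(** The product of two distinct J's is up to sign the third, which is traceless; so the trace form
    is diagonal on [G] and reads off coordinates. *)
Lemma trace_span (b : 'I_3 -> R) (B : V -> V) :
    (forall x, B x = b 0 *: J1 x + b 1 *: J2 x + b 2%:R *: J3 x) ->
  forall a, trace (fun x => J a (B x)) = - eps R a * b a * (4 * n)%:R.
Proof.
move=> Bb.
pose L a b1 b2 b3 x := b1 *: J a (J1 x) + b2 *: J a (J2 x) + b3 *: J a (J3 x).
have LE a : trace (fun x => J a (B x)) = trace (L a (b 0) (b 1) (b 2%:R)).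
  by apply: eq_trace => x; rewrite Bb !linearD !linearZ.
have trL a : trace (L a (b 0) (b 1) (b 2%:R)) = b 0 * trace (fun x => J a (J1 x))
    + b 1 * trace (fun x => J a (J2 x)) + b 2%:R * trace (fun x => J a (J3 x)).
  by rewrite !(traceD g_nondeg) !(traceZ g_nondeg).
have trN (h : V -> V) (A : 'End(V)) : trace A = 0 -> (forall x, h x = - A x) ->
    trace h = 0.
  by move=> A0 hA; rewrite (eq_trace hA) (traceN g_nondeg) A0 oppr0.
have trP (h : V -> V) (A : 'End(V)) : trace A = 0 -> (forall x, h x = A x) ->
    trace h = 0.
  by move=> A0 hA; rewrite (eq_trace hA).
have tr1 : trace (fun x : V => x) = (4 * n)%:R.
  by rewrite (trace_id g_nondeg) dimV.
have tJ := trace_J.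
apply: ord3_ind; rewrite LE trL.
- rewrite (eq_trace J11) (eq_trace J12) (eq_trace J13) !(traceN g_nondeg) !tJ tr1 eps0.
  by ring.
- rewrite (eq_trace J21) (eq_trace J22) (eq_trace J23) !(traceN g_nondeg) !tJ tr1 eps1.
  by ring.
- rewrite (eq_trace J31) (eq_trace J32) (eq_trace J33) !tJ tr1 eps2.
  by ring.
Qed.

(** Cyclicity of the trace turns a bracket with A into the bracket [J_b, J_c] paired with A. *)
Lemma trace_J_bracket A b c : trace (fun x => J c (bracket A (J b) x)) =
  trace (fun x => J b (J c (A x))) - trace (fun x => J c (J b (A x))).
Proof.
rewrite -(traceN g_nondeg).
have -> : trace (fun x => J b (J c (A x))) = trace (fun x => J c (A (J b x))).
  have := trace_mulC g_nondeg (J b) (J c \o A)%VF.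
  rewrite (@eq_trace _ _ _ (fun x => J b (J c (A x)))) => [->|x].
    by apply: eq_trace => x; rewrite comp_lfunE.
  by rewrite comp_lfunE.
rewrite -(traceD g_nondeg); apply: eq_trace => x.
by rewrite bracketE linearB.
Qed.

(** The brackets lie in [G], so [trace_span] gives their coordinates. By [trace_J_bracket] each
    relevant trace is zero or 2 t_a up to sign; division by the dimension 4n leaves 1/(2n). *)
Lemma normalizer_bracket A : normalizer G A -> let t a := trJ a A in
  [/\ forall x, bracket A J1 x = (2 * n%:R)^-1 *: (t 2%:R *: J2 x - t 1 *: J3 x),
      forall x, bracket A J2 x = (2 * n%:R)^-1 *: (t 2%:R *: J1 x - t 0 *: J3 x) &
      forall x, bracket A J3 x = (2 * n%:R)^-1 *: (t 0 *: J2 x - t 1 *: J1 x)].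
Proof.
move=> nA t.
have tM a b c e : (forall x, J a (J b x) = e *: J c x) ->
    trace (fun x => J a (J b (A x))) = e * t c.
  move=> Jab; rewrite /t /trJ -(traceZ g_nondeg); exact: eq_trace.
have t0 b : trace (fun x => J b (J b (A x))) - trace (fun x => J b (J b (A x))) = 0.
  exact: subrr.
have t12 := @tM 0 1 2%:R 1 (fun x => etrans (J12 x) (esym (scale1r _))).
have t21 := @tM 1 0 2%:R (-1) (fun x => etrans (J21 x) (esym (scaleN1r _))).
have t23 := @tM 1 2%:R 0 (-1) (fun x => etrans (J23 x) (esym (scaleN1r _))).
have t32 := @tM 2%:R 1 0 1 (fun x => etrans (J32 x) (esym (scale1r _))).
have t31 := @tM 2%:R 0 1 1 (fun x => etrans (J31 x) (esym (scale1r _))).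
have t13 := @tM 0 2%:R 1 (-1) (fun x => etrans (J13 x) (esym (scaleN1r _))).
(* This solves [trace_span] for the coordinate, [eps R a] being its own inverse. *)
have dE a (u w : R) : w = - eps R a * u * (4 * n)%:R ->
    u = - (2 * n%:R)^-1 * (eps R a * w / 2).
  have e2 : eps R a * eps R a = 1.
    by elim/ord3_ind: a; rewrite ?eps0 ?eps1 ?eps2; ring.
  by move=> ->; rewrite natrM; transitivity (eps R a * eps R a * u); [rewrite e2 mul1r|field].
split=> x.
- have [d Bd] := span_J (nA _ (mem_J 0)).
  have tJ a := esym (trace_span Bd a); have bJ := trace_J_bracket A 0; rewrite Bd.
  have -> : d 0 = 0 by rewrite (dE _ _ _ (esym (tJ 0))) bJ t0; ring.
  have -> : d 1 = (2 * n%:R)^-1 * t 2%:R.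
    by rewrite (dE _ _ _ (esym (tJ 1))) bJ t12 t21 eps1; field.
  have -> : d 2%:R = - ((2 * n%:R)^-1 * t 1).
    by rewrite (dE _ _ _ (esym (tJ 2%:R))) bJ t13 t31 eps2; field.
  by rewrite scale0r add0r scaleNr scalerBr !scalerA.
- have [d Bd] := span_J (nA _ (mem_J 1)).
  have tJ a := esym (trace_span Bd a); have bJ := trace_J_bracket A 1; rewrite Bd.
  have -> : d 1 = 0 by rewrite (dE _ _ _ (esym (tJ 1))) bJ t0; ring.
  have -> : d 0 = (2 * n%:R)^-1 * t 2%:R.
    by rewrite (dE _ _ _ (esym (tJ 0))) bJ t12 t21 eps0; field.
  have -> : d 2%:R = - ((2 * n%:R)^-1 * t 0).
    by rewrite (dE _ _ _ (esym (tJ 2%:R))) bJ t23 t32 eps2; field.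
  by rewrite scale0r addr0 scaleNr scalerBr !scalerA.
- have [d Bd] := span_J (nA _ (mem_J 2%:R)).
  have tJ a := esym (trace_span Bd a); have bJ := trace_J_bracket A 2%:R; rewrite Bd.
  have -> : d 2%:R = 0 by rewrite (dE _ _ _ (esym (tJ 2%:R))) bJ t0; ring.
  have -> : d 0 = - ((2 * n%:R)^-1 * t 1).
    by rewrite (dE _ _ _ (esym (tJ 0))) bJ t13 t31 eps0; field.
  have -> : d 1 = (2 * n%:R)^-1 * t 0.
    by rewrite (dE _ _ _ (esym (tJ 1))) bJ t23 t32 eps1; field.
  by rewrite scale0r addr0 scaleNr addrC scalerBr !scalerA.
Qed.

End ParaHypercomplex.

(** * Curvature tensors with values in the normalizer *)

Section Curvature.
Variables (R : realType) (V : vectType R) (J : 'I_3 -> 'End(V)) (G : {vspace 'End(V)}).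
Variables (g : {symmetric V}) (n : nat).
Hypothesis g_nondeg : nondegenerate g.
Hypothesis Jpara : para_hypercomplex J.
Hypothesis GJ : basis_of G [seq J a | a : 'I_3].
Hypothesis Jskew : forall a, Defs.skew g (J a).
Hypothesis dimV : \dim {:V} = (4 * n)%N.
Hypothesis n_gt1 : (2 <= n)%N.

Local Notation J1 := (J 0).
Local Notation J2 := (J 1).
Local Notation J3 := (J 2%:R).
Local Notation JE := (para_mulE Jpara).
Local Notation v i := ((vbasis {:V})`_(i : 'I_(\dim {:V}))).
Local Notation d := (dual_vbasis g).
Local Notation lfunE := (lfunD, lfunN, lfunZ, add_lfunE, opp_lfunE, scale_lfunE).

Lemma curvatureS (L L' : set 'End(V)) : L `<=` L' -> curvature L `<=` curvature L'.
Proof. by move=> LL' T [TX TL TB]; split=> // X Y; apply/LL'/TL. Qed.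

Section CurvatureTensor.
Variable T : 'Hom(V, 'Hom(V, 'End(V))).
Hypothesis T_curv : curvature (Defs.skew g) T.

Lemma curv_swap X Y : T X Y = - T Y X.
Proof.
have [TX _ _] := T_curv; apply/eqP; rewrite -addr_eq0; apply/eqP.
by have := TX (X + Y); rewrite !lfunE !TX add0r addr0 addrC.
Qed.

Lemma curv_swapE X Y Z : T X Y Z = - T Y X Z.
Proof. by rewrite curv_swap opp_lfunE. Qed.

Lemma curv_skew X Y Z W : g (T X Y Z) W = - g (T X Y W) Z.
Proof. by have [_ + _] := T_curv; move=> -> ; rewrite formC. Qed.

Lemma curv_pair X Y Z W : g (T X Y Z) W = g (T Z W X) Y.
Proof.
apply: (pair_symmetry (t := fun x y z w => g (T x y z) w)) => [x y z w|x y z w|x y z w].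
- by rewrite curv_swapE formNl.
- exact: curv_skew.
- by have [_ _ TB] := T_curv; rewrite -!formDl TB form0l.
Qed.

(* The value of the curvature operator on the bivector dual to the form g(J a -, -). *)
Definition curv_op a : 'End(V) := \sum_i T (v i) (J a (d i)).
Definition ricci_op X : V := \sum_i T X (v i) (d i).

Local Notation k := curv_op.
Local Notation rho := ricci_op.

Lemma curv_opE a X : k a X = \sum_i T (v i) (J a (d i)) X.
Proof. by rewrite sum_lfunE. Qed.

(** Pair symmetry moves the trace from the value of T to its arguments. *)
Lemma trace_curv a X Y : trace (fun Z => J a (T X Y Z)) = - g (k a X) Y.
Proof.
rewrite (traceE g_nondeg) curv_opE form_suml -sumrN; apply: eq_bigr => i _.
by rewrite curv_pair [LHS]formC Jskew curv_skew opprK.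
Qed.

Lemma curv_op_skew a : Defs.skew g (k a).
Proof.
move=> X Y; rewrite !curv_opE !formE -sumrN; apply: eq_bigr => i _.
by rewrite [g X _]formC -curv_skew.
Qed.

(** Bianchi yields two sums, which agree once J_a is moved across the identity tensor and the
    factors are exchanged. *)
Lemma curv_op_bianchi a X : k a X = - (2 *: \sum_i T X (v i) (J a (d i))).
Proof.
have [_ _ TB] := T_curv; rewrite curv_opE.
transitivity (\sum_i (- T (J a (d i)) X (v i) - T X (v i) (J a (d i)))).
  apply: eq_bigr => i _; have /eqP := TB (v i) (J a (d i)) X.
  by rewrite -addrA addr_eq0 => /eqP->; rewrite opprD.
rewrite big_split !sumrN /= -opprD scaler_nat mulr2n; congr (- (_ + _)).
rewrite (sum_dual_skew g_nondeg (F := fun Y Z => T Y X Z) (Jskew a))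
  => [|Y c Z W|Y c Z W].
- rewrite -sumrN -(sum_dualC g_nondeg (F := fun Y Z => T X Y (J a Z)))
    => [|Y c Z W|Y c Z W].
  + by apply: eq_bigr => i _; rewrite -curv_swapE.
  + by rewrite !lfunE.
  + by rewrite !lfunE.
- by rewrite !lfunE.
- by rewrite !lfunE.
Qed.

Lemma ricci_opE X Y : Ric T X Y = g (rho X) Y.
Proof.
rewrite /Ric (traceE g_nondeg) form_suml; apply: eq_bigr => i _.
by rewrite formC curv_swapE formNl [RHS]curv_skew.
Qed.

Lemma ricci_op_sym X Y : g (rho X) Y = g X (rho Y).
Proof.
rewrite !formE.
have -> : \sum_i g X (T Y (v i) (d i)) = \sum_i g (T Y (d i) (v i)) X.
  under eq_bigr do rewrite formC.
  rewrite (sum_dualC g_nondeg (W := R^o) (F := fun Z W => g (T Y Z W) X))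
    => [|Z c W W'|Z c W W'] //.
    by rewrite !lfunE !formE.
  by rewrite !lfunE !formE.
by apply: eq_bigr => i _; rewrite curv_pair curv_swapE formNl [RHS]curv_skew.
Qed.

(** Pulling J_a out of T(X, v_i) leaves the Ricci operator and brackets that [normalizer_bracket]
    evaluates. *)
Lemma curv_op_ricci a X :
  k a X = - (2 *: (J a (rho X) + \sum_i bracket (T X (v i)) (J a) (d i))).
Proof.
rewrite curv_op_bianchi lfun_sum -big_split /=; congr (- (_ *: _)).
by apply: eq_bigr => i _; rewrite bracketE addrC subrK.
Qed.

Section Normalizer.
Hypothesis T_norm : forall X Y, autG G (T X Y).

Let lin_trace a X : \sum_i trace (fun Z => J a (T X (v i) Z)) *: d i = - k a X.
Proof.
rewrite [k a X in RHS](vbasis_decomp g_nondeg) -sumrN.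
by apply: eq_bigr => i _; rewrite trace_curv scaleNr formC.
Qed.

Let lin_traceJ a b X :
  \sum_i trace (fun Z => J a (T X (v i) Z)) *: J b (d i) = - J b (k a X).
Proof.
by rewrite -lfunN -lin_trace lfun_sum; apply: eq_bigr => i _; rewrite lfunZ.
Qed.

(** The bracket coefficients are values of the forms g(k_b X, -); contracting them with the dual
    basis returns k_b X, which closes the system. *)
Let curv_op_system X : [/\
  k 0 X = - 2 *: (J1 (rho X)) + n%:R^-1 *: (J2 (k 2%:R X) - J3 (k 1 X)),
  k 1 X = - 2 *: (J2 (rho X)) + n%:R^-1 *: (J1 (k 2%:R X) - J3 (k 0 X)) &
  k 2%:R X = - 2 *: (J3 (rho X)) + n%:R^-1 *: (J2 (k 0 X) - J1 (k 1 X))].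
Proof.
have n0 : n%:R != 0 :> R by rewrite pnatr_eq0 -lt0n ltnW.
have nb Y := normalizer_bracket Jpara GJ g_nondeg Jskew dimV n_gt1 (T_norm X Y).
have nb1 Y : forall Z, _ := let: And3 h _ _ := nb Y in h.
have nb2 Y : forall Z, _ := let: And3 _ h _ := nb Y in h.
have nb3 Y : forall Z, _ := let: And3 _ _ h := nb Y in h.
have coef (x y : V) : 2 *: ((2 * n%:R)^-1 *: (- x - - y)) = - (n%:R^-1 *: (x - y)).
  by rewrite -opprD !scalerN scalerA; congr (- (_ *: _)); field.
split; rewrite curv_op_ricci scalerDr opprD -scaleNr; congr (_ + _).
- under eq_bigr => i _ do rewrite nb1.
  by rewrite -scaler_sumr sumrB !lin_traceJ coef opprK.
- under eq_bigr => i _ do rewrite nb2.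
  by rewrite -scaler_sumr sumrB !lin_traceJ coef opprK.
- under eq_bigr => i _ do rewrite nb3.
  by rewrite -scaler_sumr sumrB !lin_traceJ coef opprK.
Qed.

Let curv_op_solve X : [/\ J2 (k 1 X) = - J1 (k 0 X), J3 (k 2%:R X) = - J1 (k 0 X) &
  2 *: rho X = (1 + 2 * n%:R^-1) *: J1 (k 0 X)].
Proof.
have [e1 e2 e3] := curv_op_system X.
set m : R := n%:R^-1 in e1 e2 e3 *.
(* For n = 1 this coefficient vanishes and the system degenerates. *)
have m1 : 1 - m != 0.
  by rewrite subr_eq0 eq_sym invr_eq1 pnatr_eq1; case: n n_gt1 => [|[]].
have {}e1 : J1 (k 0 X) = 2 *: rho X + m *: (J3 (k 2%:R X) + J2 (k 1 X)).
  by rewrite [in LHS]e1 !lfunE !(JE, scaleNr, opprK, scalerN); congr (_ + _ *: _).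
have {}e2 : J2 (k 1 X) = - 2 *: rho X + m *: (J1 (k 0 X) - J3 (k 2%:R X)).
  by rewrite [in LHS]e2 !lfunE !JE opprK [- _ + _]addrC.
have {}e3 : J3 (k 2%:R X) = - 2 *: rho X + m *: (J1 (k 0 X) - J2 (k 1 X)).
  by rewrite [in LHS]e3 !lfunE !JE.
have f1 W := congr1 (g^~ W) e1.
have f2 W := congr1 (g^~ W) e2.
have f3 W := congr1 (g^~ W) e3.
(* The sum of the first two equations is (1 - m)(J1 (k 0 X) + J2 (k 1 X)) = 0; the third is treated
   like the second. *)
have h2 W : g (J2 (k 1 X)) W = - g (J1 (k 0 X)) W.
  apply: (mulfI m1); move: (f1 W) (f2 W); rewrite !formE; lra.
have h3 W : g (J3 (k 2%:R X)) W = - g (J1 (k 0 X)) W.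
  apply: (mulfI m1); move: (f1 W) (f3 W); rewrite !formE; lra.
split; apply: (form_inj g_nondeg) => W; rewrite !formE //.
move: (f1 W); rewrite !formE h2 h3; lra.
Qed.

Let P : 'End(V) := (J1 \o k 0)%VF.

Let k_P a X : k a X = - J a (P X).
Proof.
have [h2 h3 _] := curv_op_solve X.
elim/ord3_ind: a; rewrite comp_lfunE; first by rewrite JE opprK.
  by rewrite -[J1 (k 0 X)]opprK -h2 !lfunE JE opprK.
by rewrite -[J1 (k 0 X)]opprK -h3 !lfunE JE opprK.
Qed.

Let P_sym X Y : g (P X) Y = g X (P Y).
Proof.
have r0 : 1 + 2 * n%:R^-1 != 0 :> R.
  by rewrite gt_eqF // ltr_wpDr // mulr_ge0 // invr_ge0 ler0n.
have [_ _ rX] := curv_op_solve X; have [_ _ rY] := curv_op_solve Y.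
apply: (mulfI r0); rewrite -formZl -formZr !comp_lfunE -rX -rY formZl formZr.
by rewrite ricci_op_sym.
Qed.

Let P_comm a X : P (J a X) = J a (P X).
Proof.
apply: (form_inj g_nondeg) => W.
rewrite P_sym Jskew -formNr -k_P -[J a (P X)]opprK -k_P formNl curv_op_skew.
by rewrite opprK.
Qed.

Lemma curv_op_scalar : exists mu,
  (forall a X, k a X = - mu *: J a X) /\
  (forall X, 2 *: rho X = ((1 + 2 * n%:R^-1) * mu) *: X).
Proof.
have nk : normalizer G (k 0).
  move=> B BG; rewrite (_ : bracket _ _ = \sum_i bracket (T (v i) (J1 (d i))) B).
    by rewrite memv_suml // => i _; exact: T_norm.
  apply/lfunP => x; rewrite bracketE sum_lfunE !curv_opE lfun_sum -sumrB.
  by apply: eq_bigr => i _; rewrite bracketE.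
have [_ brk _] := normalizer_bracket Jpara GJ g_nondeg Jskew dimV n_gt1 nk.
move: (trace _) (trace _) brk => q p brk.
(* As P commutes with the J's, the bracket of [k 0] with J2 is - 2 J3 P; apply J3. *)
have PE X : - 2 *: P X = (2 * n%:R)^-1 *: (p *: J2 X - q *: X).
  have /(congr1 J3) := brk X.
  by rewrite bracketE !k_P P_comm !lfunE !JE opprK scaleNr scaler_nat mulr2n opprD.
pose mu := (2 * n%:R)^-1 * q / 2.
(* P is symmetric and J2 skew, so only the identity part survives symmetrization. *)
have P_mu X : P X = mu *: X.
  apply: (form_inj g_nondeg) => W; rewrite formZl.
  have E1 : g (P W) X = g (P X) W by rewrite P_sym formC.
  have E2 : g (J2 W) X = - g (J2 X) W by rewrite Jskew formC.
  have := congr1 (g^~ W) (PE X); have := congr1 (g^~ X) (PE W).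
  rewrite !formE E1 E2 [g W X]formC /mu; lra.
exists mu; split=> [a X|X]; first by rewrite k_P P_mu lfunZ scaleNr.
by have [_ _ ->] := curv_op_solve X; rewrite -comp_lfunE -/P P_mu scalerA.
Qed.

Lemma curvature_scalar : exists mu, [/\
  forall X Y, Ric T X Y = (1 + 2 * n%:R^-1) * mu / 2 * g X Y,
  forall a X Y, trace (fun Z => J a (T X Y Z)) = mu * g (J a X) Y &
  forall X Y, [/\
    forall Z, bracket (T X Y) J1 Z =
      (mu / (2 * n%:R)) *: (g (J3 X) Y *: J2 Z - g (J2 X) Y *: J3 Z),
    forall Z, bracket (T X Y) J2 Z =
      (mu / (2 * n%:R)) *: (g (J3 X) Y *: J1 Z - g (J1 X) Y *: J3 Z) &
    forall Z, bracket (T X Y) J3 Z =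
      (mu / (2 * n%:R)) *: (g (J1 X) Y *: J2 Z - g (J2 X) Y *: J1 Z)]].
Proof.
have [mu [kmu rmu]] := curv_op_scalar.
have tr a X Y : trace (fun Z => J a (T X Y Z)) = mu * g (J a X) Y.
  by rewrite trace_curv kmu formZl mulNr opprK.
exists mu; split=> // X Y.
  by rewrite ricci_opE; have := congr1 (g^~ Y) (rmu X); rewrite !formZl; lra.
have [b1 b2 b3] := normalizer_bracket Jpara GJ g_nondeg Jskew dimV n_gt1 (T_norm X Y).
have sc a b (Z Z' : V) : (2 * n%:R)^-1 *: ((mu * a) *: Z - (mu * b) *: Z') =
    (mu / (2 * n%:R)) *: (a *: Z - b *: Z').
  by rewrite -!scalerA -scalerBr !scalerA mulrC.
by split=> Z; rewrite (b1, b2, b3) !tr sc.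
Qed.

End Normalizer.

End CurvatureTensor.
End Curvature.

(** * The curvature tensor of the projective space *)

Section ProjectiveCurvature.
Variables (R : realType) (V : vectType R) (J : 'I_3 -> 'End(V)) (G : {vspace 'End(V)}).
Variables (g : {symmetric V}).
Hypothesis g_nondeg : nondegenerate g.
Hypothesis Jpara : para_hypercomplex J.
Hypothesis GJ : basis_of G [seq J a | a : 'I_3].
Hypothesis Jskew : forall a, Defs.skew g (J a).

Local Notation J1 := (J 0).
Local Notation J2 := (J 1).
Local Notation J3 := (J 2%:R).
Local Notation JE := (para_mulE Jpara).
Local Notation lfunE := (lfunD, lfunN, lfunZ, add_lfunE, opp_lfunE, scale_lfunE).

Let formJr a X Y : g X (J a Y) = - g (J a X) Y.
Proof. by rewrite Jskew opprK. Qed.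

Let formJC a X Y : g (J a X) Y = - g (J a Y) X.
Proof. by rewrite Jskew formC. Qed.

Let R_HP_formE X Y Z W : g (R_HP g J X Y Z) W =
  g Y Z * g X W - g X Z * g Y W
  + (g (J1 Y) Z * g (J1 X) W - g (J1 X) Z * g (J1 Y) W)
  - (g (J2 Y) Z * g (J2 X) W - g (J2 X) Z * g (J2 Y) W)
  - (g (J3 Y) Z * g (J3 X) W - g (J3 X) Z * g (J3 Y) W)
  - 2 * (g (J1 X) Y * g (J1 Z) W - g (J2 X) Y * g (J2 Z) W - g (J3 X) Y * g (J3 Z) W).
Proof. by rewrite R_HPE !sum_ord3 eps0 eps1 eps2 !formE; ring. Qed.

Lemma R_HP_bracket X Y : [/\
  forall Z, bracket (R_HP g J X Y) J1 Z =
    4 *: (g (J3 X) Y *: J2 Z - g (J2 X) Y *: J3 Z),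
  forall Z, bracket (R_HP g J X Y) J2 Z =
    4 *: (g (J3 X) Y *: J1 Z - g (J1 X) Y *: J3 Z) &
  forall Z, bracket (R_HP g J X Y) J3 Z =
    4 *: (g (J1 X) Y *: J2 Z - g (J2 X) Y *: J1 Z)].
Proof.
by split=> Z; apply: (form_inj g_nondeg) => W;
  rewrite bracketE !formE Jskew !R_HP_formE !formJr !(JE, formE); ring.
Qed.

Lemma R_HP_curvature : curvature (spG g G) (R_HP g J).
Proof.
split=> [X|X Y|X Y Z].
- apply/lfunP => Z; apply: (form_inj g_nondeg) => W.
  by rewrite zero_lfunE formE R_HP_formE !(skew_self _ (Jskew _)); ring.
- split=> [B BG|Z W]; last first.
    rewrite [g Z _]formC !R_HP_formE !(formJC _ W Z); ring.
  have [b Bb] := span_J GJ BG; have [b1 b2 b3] := R_HP_bracket X Y.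
  rewrite (_ : bracket _ B = b 0 *: bracket (R_HP g J X Y) J1
    + b 1 *: bracket (R_HP g J X Y) J2
    + b 2%:R *: bracket (R_HP g J X Y) J3); last first.
    apply/lfunP => Z; rewrite !(bracketE, lfunE) !Bb !lfunE.
    by apply: (form_inj g_nondeg) => W; rewrite !formE; ring.
  have inG a c (p q : R) : p *: J a - q *: J c \in G.
    by rewrite rpredB // rpredZ // mem_J.
  rewrite !rpredD // rpredZ //.
  + rewrite (_ : bracket _ _ = 4 *: (g (J3 X) Y *: J2 - g (J2 X) Y *: J3)) ?rpredZ //.
    by apply/lfunP => Z; rewrite b1 !lfunE.
  + rewrite (_ : bracket _ _ = 4 *: (g (J3 X) Y *: J1 - g (J1 X) Y *: J3)) ?rpredZ //.
    by apply/lfunP => Z; rewrite b2 !lfunE.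
  + rewrite (_ : bracket _ _ = 4 *: (g (J1 X) Y *: J2 - g (J2 X) Y *: J1)) ?rpredZ //.
    by apply/lfunP => Z; rewrite b3 !lfunE.
- apply: (form_inj g_nondeg) => W; rewrite !formE !R_HP_formE.
  rewrite !(formJC _ Y X) !(formJC _ Z X) !(formJC _ Z Y).
  rewrite !(formC g Y X) !(formC g Z X) !(formC g Z Y).
  by ring.
Qed.

End ProjectiveCurvature.

(** * Einstein property, splitting and Ricci flatness *)

Section Decomposition.
Variables (R : realType) (V : vectType R) (J : 'I_3 -> 'End(V)) (G : {vspace 'End(V)}).
Variables (g : {symmetric V}) (n : nat).
Hypothesis g_nondeg : nondegenerate g.
Hypothesis Jpara : para_hypercomplex J.
Hypothesis GJ : basis_of G [seq J a | a : 'I_3].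
Hypothesis Jskew : forall a, Defs.skew g (J a).
Hypothesis dimV : \dim {:V} = (4 * n)%N.
Hypothesis n_gt1 : (2 <= n)%N.

Local Notation J1 := (J 0).
Local Notation J2 := (J 1).
Local Notation J3 := (J 2%:R).
Local Notation lfunE := (lfunD, lfunN, lfunZ, add_lfunE, opp_lfunE, scale_lfunE).

Lemma spH_commute A a X : spH g G A -> A (J a X) = J a (A X).
Proof.
move=> [/(_ _ (mem_J GJ a)) AJ _].
by apply/eqP; rewrite -subr_eq0 -bracketE AJ zero_lfunE.
Qed.

Lemma spHP A : Defs.skew g A -> (forall a X, A (J a X) = J a (A X)) -> spH g G A.
Proof.
move=> skA AJ; split=> // B /(span_J GJ)[b Bb]; apply/lfunP => X.
by rewrite bracketE !Bb !lfunE !AJ subrr zero_lfunE.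
Qed.

Lemma spH_spG : spH g G `<=` spG g G.
Proof. by move=> A [cA skA]; split=> // B BG; rewrite cA // mem0v. Qed.

Lemma spG_skew : spG g G `<=` Defs.skew g.
Proof. by move=> A []. Qed.

Lemma curvature_lin (L : set 'End(V)) c S T :
    (forall a A B, L A -> L B -> L (a *: A + B)) ->
  curvature L S -> curvature L T -> curvature L (c *: S + T).
Proof.
move=> lL [SX SL SB] [TX TL TB]; split=> [X|X Y|X Y Z]; rewrite !lfunE.
- by rewrite SX TX scaler0 addr0.
- exact: lL.
- transitivity (c *: (S X Y Z + S Y Z X + S Z X Y) + (T X Y Z + T Y Z X + T Z X Y)).
    by rewrite !scalerDr [RHS]addrACA [X in _ = X + _]addrACA.
  by rewrite SB TB scaler0 addr0.
Qed.

Lemma skew_lin a A B : Defs.skew g A -> Defs.skew g B -> Defs.skew g (a *: A + B).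
Proof. by move=> sA sB X Y; rewrite !lfunE !formE sA sB; ring. Qed.

Lemma bracket_lin (a : R) (A B C : 'End(V)) :
  bracket (a *: A + B) C = a *: bracket A C + bracket B C.
Proof.
apply/lfunP => X; rewrite !(bracketE, lfunE) scalerBr.
by rewrite opprD addrACA.
Qed.

Lemma spG_lin a A B : spG g G A -> spG g G B -> spG g G (a *: A + B).
Proof.
move=> [nA sA] [nB sB]; split; last exact: skew_lin.
by move=> C CG; rewrite bracket_lin rpredD ?rpredZ ?nA ?nB.
Qed.

Lemma spH_lin a A B : spH g G A -> spH g G B -> spH g G (a *: A + B).
Proof.
move=> [nA sA] [nB sB]; split; last exact: skew_lin.
by move=> C CG; rewrite bracket_lin nA // nB // scaler0 addr0.
Qed.

Lemma curvature_spG_scalar T : curvature (spG g G) T -> exists mu,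
  [/\ forall X Y, Ric T X Y = (1 + 2 * n%:R^-1) * mu / 2 * g X Y,
      forall a X Y, trace (fun Z => J a (T X Y Z)) = mu * g (J a X) Y &
      curvature (spH g G) (T - mu / (8 * n%:R) *: R_HP g J)].
Proof.
move=> cT; have scT := curvatureS spG_skew cT.
have nT X Y : autG G (T X Y) by have [_ /(_ X Y)[]] := cT.
have [mu [ricT trT brT]] := curvature_scalar g_nondeg Jpara GJ Jskew dimV n_gt1 scT nT.
exists mu; split=> //; set c := _ / _.
have c4 : c * 4 = mu / (2 * n%:R).
  by rewrite /c; field; rewrite pnatr_eq0 -lt0n ltnW.
have [DX DL DB] : curvature (spG g G) (T - c *: R_HP g J).
  rewrite addrC -scaleNr; apply: curvature_lin => //; first exact: spG_lin.
  exact: R_HP_curvature.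
split=> // X Y; apply: spHP => [|a Z]; first by have [] := DL X Y.
apply/eqP; rewrite -subr_eq0 -bracketE; apply/eqP.
have -> : (T - c *: R_HP g J) X Y = - c *: R_HP g J X Y + T X Y.
  by rewrite !lfunE scaleNr addrC.
rewrite bracket_lin add_lfunE scale_lfunE.
have [r1 r2 r3] := R_HP_bracket g_nondeg Jpara Jskew X Y.
have [t1 t2 t3] := brT X Y.
by elim/ord3_ind: a; rewrite (r1, r2, r3) (t1, t2, t3) scaleNr scalerA c4 addNr.
Qed.

(** J3 is half the commutator of J1 and J2, and the trace of a commutator against an A commuting
    with both is zero. *)
Lemma trace_commuting (A : 'End(V)) : (forall a X, A (J a X) = J a (A X)) ->
  trace (fun X => J3 (A X)) = 0.
Proof.
move=> AJ; have := trace_J_bracket J g_nondeg A 0 1.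
rewrite (@eq_trace _ _ (fun X => J1 (J2 (A X))) (fun X => J3 (A X))) => [|X];
  last by rewrite J12.
rewrite (@eq_trace _ _ (fun X => J2 (J1 (A X))) (fun X => - J3 (A X))) => [|X];
  last by rewrite J21.
rewrite (traceN g_nondeg) (@eq_trace _ _ _ (fun X => 0 *: X)) => [|X]; last first.
  by rewrite bracketE AJ subrr linear0 scale0r.
rewrite (traceZ g_nondeg); lra.
Qed.

(** By [trace_commuting], mu g(J3 W, Z) = 0 for all W and Z; nondegeneracy gives mu = 0, and the
    Ricci tensor is a multiple of mu. *)
Lemma curvature_spH_Weyl : curvature (spH g G) `<=` Weyl G.
Proof.
move=> T cT; have cG := curvatureS spH_spG cT.
have [mu [ricT trT _]] := curvature_spG_scalar cG.
split=> [|X Y]; first by apply: curvatureS cG => A [].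
suff mu0 : mu = 0 by rewrite ricT mu0 mulr0 !mul0r.
have [_ TL _] := cT.
have [W W0] : exists W : V, W != 0.
  exists (vpick {:V}); rewrite vpick0 -dimv_eq0 dimV muln_eq0 negb_or /=.
  by rewrite -lt0n ltnW.
have [|Z] := form_neq0 g_nondeg (X := J3 W).
  by apply: contra_neq W0 => /(congr1 J3); rewrite J33 // linear0.
move=> gZ; have := trT 2%:R W Z.
rewrite trace_commuting; last by move=> a U; exact/spH_commute/TL.
by move/esym/eqP; rewrite mulf_eq0 (negPf gZ) orbF => /eqP.
Qed.

Lemma einstein T : curvature (spG g G) T ->
  forall X Y, Ric T X Y = scal g T / (4 * n)%:R * g X Y.
Proof.
move=> /curvature_spG_scalar[mu [ricT _ _]] X Y.
have n0 : (4 * n)%:R != 0 :> R by rewrite pnatr_eq0 muln_eq0 /= -lt0n ltnW.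
have -> : scal g T = (1 + 2 * n%:R^-1) * mu / 2 * (4 * n)%:R.
  rewrite -dimV -(gtraceZ g_nondeg); congr gtrace.
  by apply/funext => U; apply/funext => U'; exact: ricT.
by rewrite mulfK // ricT.
Qed.

Lemma curvature_spG_decomp : curvature (spG g G) =
  [set c *: R_HP g J + T | c in [set: R] & T in curvature (spH g G)].
Proof.
apply/seteqP; split=> [T /curvature_spG_scalar[mu [_ _ cT]]|_ [c _ [T cT <-]]].
  exists (mu / (8 * n%:R)) => //; exists (T - mu / (8 * n%:R) *: R_HP g J) => //.
  by rewrite addrC subrK.
apply: curvature_lin; [exact: spG_lin| |exact: curvatureS spH_spG _ cT].
exact: R_HP_curvature.
Qed.

(** sp(H) is an ideal of sp(G): by Jacobi, for C in [G] only [B, C] and [B, [A, C]] occur, and both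
    C and [A, C] lie in [G]. *)
Lemma bracket_spH A B : spG g G A -> spH g G B -> spH g G (bracket A B).
Proof.
move=> [nA sA] [cB sB]; split=> [C CG|X Y].
  have BC D Z : D \in G -> B (D Z) = D (B Z).
    by move=> DG; apply/eqP; rewrite -subr_eq0 -bracketE cB // zero_lfunE.
  apply/lfunP => X; apply: (form_inj g_nondeg) => W.
  have := congr1 (g^~ W) (BC _ X (nA _ CG)).
  have := congr1 (g^~ W) (BC C (A X) CG).
  rewrite !(bracketE, lfunE) zero_lfunE (BC C X CG) !formE; lra.
by rewrite !bracketE !formE sA !sB sA; ring.
Qed.

Lemma act_curvature_spH A T : spG g G A -> curvature (spH g G) T ->
  curvature (spH g G) (act A T).
Proof.
move=> GA cT; have [TX TL TB] := cT.
have cS := curvatureS (@spG_skew) (curvatureS spH_spG cT).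
split=> [X|X Y|X Y Z].
- rewrite actE TX (curv_swap cS X) opprK addrNK.
  by apply/lfunP => Y; rewrite bracketE !zero_lfunE linear0 subrr.
- rewrite actE -!scaleN1r addrC; apply: spH_lin => //.
  by rewrite addrC; apply: spH_lin => //; exact: bracket_spH.
- apply: (form_inj g_nondeg) => W; rewrite !actE !(bracketE, lfunE).
  have := congr1 (g^~ W) (TB (A X) Y Z); have := congr1 (g^~ W) (TB X (A Y) Z).
  have := congr1 (g^~ W) (TB X Y (A Z)).
  have := congr1 (fun U => g (A U) W) (TB X Y Z).
  rewrite !lfunE !formE linear0 formE; lra.
Qed.

Lemma spH_submodule :
  submodule (spG g G) (curvature (spG g G)) (curvature (spH g G)).
Proof.
split; [exact: curvatureS spH_spG | | |exact: act_curvature_spH].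
- split=> [X|X Y|X Y Z]; rewrite !zero_lfunE ?addr0 //.
  split=> [B BG|X' Y']; last by rewrite !zero_lfunE !formE oppr0.
  by apply/lfunP => x; rewrite bracketE !zero_lfunE linear0 subrr.
- by move=> a S T cS cT; apply: curvature_lin => //; exact: spH_lin.
Qed.

End Decomposition.

(** * Irreducibility through quartic forms on the + 1 eigenspace E of J2 *)

Section Irreducibility.
Variables (R : realType) (V : vectType R) (J : 'I_3 -> 'End(V)) (G : {vspace 'End(V)}).
Variables (g : {symmetric V}).
Hypothesis g_nondeg : nondegenerate g.
Hypothesis Jpara : para_hypercomplex J.
Hypothesis GJ : basis_of G [seq J a | a : 'I_3].
Hypothesis Jskew : forall a, Defs.skew g (J a).

Local Notation J1 := (J 0).
Local Notation J2 := (J 1).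
Local Notation J3 := (J 2%:R).
Local Notation JE := (para_mulE Jpara).
Local Notation v i := ((vbasis {:V})`_(i : 'I_(\dim {:V}))).
Local Notation d := (dual_vbasis g).
Local Notation lfunE := (lfunD, lfunN, lfunZ, add_lfunE, opp_lfunE, scale_lfunE).
Local Notation bilEnd := 'Hom(V, 'Hom(V, 'End(V))).
Local Notation N := (curvature (spH g G)).

(* Locked, so that rewriting with add_lfunE and scale_lfunE does not see the sum. *)
Definition eigen_proj : 'End(V) := locked (2^-1 *: (\1%VF + J2)).
Local Notation pr := eigen_proj.

Lemma eigen_projE x : pr x = 2^-1 *: (x + J2 x).
Proof. by rewrite /eigen_proj -lock !lfunE id_lfunE. Qed.

Lemma J2_pr x : J2 (pr x) = pr x.
Proof. by rewrite eigen_projE lfunZ lfunD JE addrC. Qed.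

Lemma pr_pr x : pr (pr x) = pr x.
Proof.
rewrite eigen_projE J2_pr -mulr2n -scaler_nat scalerA mulVf ?scale1r //.
by rewrite pnatr_eq0.
Qed.

Lemma J3_pr x : J3 (pr x) = J1 (pr x).
Proof. by rewrite -(J12 Jpara) J2_pr. Qed.

(** J1 exchanges the eigenspaces of J2, so - J1 pr J1 is the complementary projection; this encodes
    V = E + J1 E. *)
Lemma pr_J1 x : J1 (pr (J1 x)) = pr x - x.
Proof.
rewrite !eigen_projE !lfunE !JE; apply: (form_inj g_nondeg) => W.
by rewrite !formE; field.
Qed.

Lemma form_pr x y : g (pr x) (pr y) = 0.
Proof.
have := Jskew 1 (pr x) (pr y); rewrite !J2_pr; lra.
Qed.

Lemma form_J1pr x y : g (J1 (pr x)) (J1 (pr y)) = 0.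
Proof. by rewrite Jskew JE formNr form_pr !oppr0. Qed.

Lemma form_prr x y : g (J1 (pr x)) (pr y) = g (J1 (pr x)) y.
Proof.
by rewrite -[pr y in LHS](subrK y) -pr_J1 formDr form_J1pr add0r.
Qed.

(** The symplectic form of E, pulled back to V so that E never has to be a type of its own. *)
Definition symp x y := g (J1 (pr x)) (pr y).
Local Notation w := symp.

Lemma sympC x y : w x y = - w y x.
Proof. by rewrite /symp Jskew formC. Qed.

Lemma symp_neq0 x : pr x != 0 -> exists y, w x y != 0.
Proof.
move=> x0; have [|y yP] := form_neq0 g_nondeg (X := J1 (pr x)).
  apply: contra_neq x0 => /(congr1 J1); rewrite JE linear0 => /eqP.
  by rewrite oppr_eq0 => /eqP.
by exists y; rewrite /symp form_prr.
Qed.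

Lemma sympDr x y z : w x (y + z) = w x y + w x z.
Proof. by rewrite /symp lfunD formDr. Qed.

Lemma sympDl x y z : w (y + z) x = w y x + w z x.
Proof. by rewrite /symp !lfunD formDl. Qed.

Lemma sympNl x y : w (- x) y = - w x y.
Proof. by rewrite /symp !lfunN formNl. Qed.

(** Two proper hyperplanes do not cover the space. This lets [submodule_veronese] pass from one
    fourth power to any other in two steps. *)
Lemma symp_neq0_common x y : pr x != 0 -> pr y != 0 ->
  exists z, w x z != 0 /\ w y z != 0.
Proof.
move=> /symp_neq0[z1 xz1] /symp_neq0[z2 yz2].
have [yz1|yz1] := eqVneq (w y z1) 0; last by exists z1.
have [xz2|xz2] := eqVneq (w x z2) 0; last by exists z2.
by exists (z1 + z2); rewrite !sympDr yz1 xz2 addr0 add0r.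
Qed.

(* This quartic form on the + 1 eigenspace of J2 is the isomorphism N = S^4 E^*. *)
Definition quartic (T : bilEnd) x y z u := g (T (pr x) (J1 (pr y)) (pr z)) (J1 (pr u)).
Local Notation S := quartic.

(** * Symmetries of the quartic form and recovery of the tensor from it *)

Section Quartic.
Variable T : bilEnd.
Hypothesis T_curv : N T.

Let T_skew : curvature (Defs.skew g) T.
Proof. exact/(curvatureS (@spG_skew _ _ G g))/(curvatureS (@spH_spG _ _ G g)). Qed.

Let T_J a X Y Z : T X Y (J a Z) = J a (T X Y Z).
Proof. by have [_ TL _] := T_curv; exact: (spH_commute GJ a Z (TL X Y)). Qed.

(** Pair symmetry transfers the commutation of the values with J_a to the arguments. *)
Let J_T a X Y : T (J a X) Y = - T X (J a Y).
Proof.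
apply/lfunP => Z; apply: (form_inj g_nondeg) => W.
by rewrite opp_lfunE formNl !(curv_pair T_skew _ _ Z) T_J Jskew.
Qed.

Let T_pr x y : T (pr x) (pr y) = 0.
Proof.
have := J_T 1 (pr x) (pr y); rewrite !J2_pr => /eqP.
by rewrite -addr_eq0 -mulr2n -scaler_nat scaler_eq0 pnatr_eq0 => /eqP.
Qed.

Lemma quartic12 x y z u : S T x y z u = S T y x z u.
Proof. by rewrite /quartic -[T (pr x) _]opprK -J_T (curv_swap T_skew) opprK. Qed.

Lemma quartic34 x y z u : S T x y z u = S T x y u z.
Proof.
by rewrite /quartic formC Jskew -T_J formC -(curv_skew T_skew) formC.
Qed.

(** Bianchi for x, J1 y, z in which the third term vanishes by [T_pr]. With [quartic12] and
    [quartic34] this gives total symmetry. *)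
Lemma quartic13 x y z u : S T x y z u = S T z y x u.
Proof.
have [_ _ TB] := T_curv; rewrite /quartic; congr (g _ _).
have := TB (pr x) (J1 (pr y)) (pr z); rewrite T_pr zero_lfunE addr0 => /eqP.
by rewrite addr_eq0 (curv_swapE T_skew (J1 _)) opprK => /eqP.
Qed.

Lemma quarticD x y x' z u : S T (x + x') y z u = S T x y z u + S T x' y z u.
Proof. by rewrite /quartic !lfunE formDl. Qed.

Lemma quarticN x y z u : S T (- x) y z u = - S T x y z u.
Proof. by rewrite /quartic !lfunE formNl. Qed.

Lemma curv_quartic X Y Z W : g (T X Y Z) W =
  S T X (J1 Y) Z (J1 W) - S T X (J1 Y) (J1 Z) W
  - S T (J1 X) Y Z (J1 W) + S T (J1 X) Y (J1 Z) W.
Proof.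
have E x : x = pr x - J1 (pr (J1 x)) by rewrite pr_J1 opprB addrC subrK.
have T_E a a' b b' : T (pr a - J1 (pr a')) (pr b - J1 (pr b')) =
    T (pr a') (J1 (pr b)) - T (pr a) (J1 (pr b')).
  by rewrite !lfunE !J_T JE lfunN !T_pr !(oppr0, opprK) add0r addr0 addrC.
have T0 x y z u : g (T x y (pr z)) (pr u) = 0.
  by have := Jskew 1 (T x y (pr z)) (pr u); rewrite -T_J !J2_pr; lra.
have gT x y z z' u u' : g (T x y (pr z - J1 (pr z'))) (pr u - J1 (pr u')) =
    g (T x y (pr z')) (J1 (pr u)) - g (T x y (pr z)) (J1 (pr u')).
  by rewrite !lfunE T_J !formE !Jskew JE formNr !T0; ring.
have gZW x y : g (T x y Z) W =
    g (T x y (pr (J1 Z))) (J1 (pr W)) - g (T x y (pr Z)) (J1 (pr (J1 W))).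
  by rewrite {1}(E Z) {1}(E W) gT.
rewrite {1}(E X) {1}(E Y) T_E add_lfunE opp_lfunE formDl formNl !gZW /quartic; ring.
Qed.

Lemma quartic_eq0 : (forall x, S T x x x x = 0) -> T = 0.
Proof.
have s12 := quartic12; have s13 := quartic13; have s34 := quartic34.
have s14 x y z u : S T x y z u = S T u y z x by rewrite s13 s34 s13.
have s24 x y z u : S T x y z u = S T x u z y by rewrite s12 s14 s12.
have s23 x y z u : S T x y z u = S T x z y u by rewrite s12 s13 s12.
have D2 x y y' z u : S T x (y + y') z u = S T x y z u + S T x y' z u.
  by rewrite !(s12 x) quarticD.
have D3 x y z z' u : S T x y (z + z') u = S T x y z u + S T x y z' u.
  by rewrite !(s13 x) quarticD.
have D4 x y z u u' : S T x y z (u + u') = S T x y z u + S T x y z u'.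
  by rewrite s34 D3 !(s34 x y _ z).
have N2 x y z u : S T x (- y) z u = - S T x y z u by rewrite !(s12 x) quarticN.
have N3 x y z u : S T x y (- z) u = - S T x y z u by rewrite !(s13 x) quarticN.
have N4 x y z u : S T x y z (- u) = - S T x y z u by rewrite s34 N3 (s34 x y u).
move=> S0.
have S22 x y : S T x x y y = 0.
  have := S0 (x + y); have := S0 (x - y); have := S0 x; have := S0 y.
  rewrite !(quarticD, D2, D3, D4, quarticN, N2, N3, N4).
  rewrite (s23 x y x y) (s24 x y y x) (s13 y x x y) (s14 y x y x) (s13 y y x x).
  rewrite (s24 x y y x); lra.
have S211 x y z : S T x x y z = 0.
  have := S22 x (y + z); rewrite D3 !D4 !S22 (s34 x x z y); lra.
have S1111 x y z u : S T x y z u = 0.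
  have := S211 (x + y) z u; rewrite quarticD !D2 !S211 (s12 y x); lra.
apply/lfunP => X; apply/lfunP => Y; apply/lfunP => Z; apply: (form_inj g_nondeg) => W.
by rewrite curv_quartic !S1111 !zero_lfunE formE; ring.
Qed.

End Quartic.

Lemma quartic_lin (c : R) (T T' : bilEnd) x y z u :
  S (c *: T + T') x y z u = c * S T x y z u + S T' x y z u.
Proof. by rewrite /quartic !lfunE !formE. Qed.

(** * Rank one elements and fourth powers of linear forms *)

Definition rank1 a : 'End(V) :=
  locked (linfun (fun X => g (J1 (pr a)) X *: pr a - g (pr a) X *: J1 (pr a))).

Lemma rank1E a X : rank1 a X = g (J1 (pr a)) X *: pr a - g (pr a) X *: J1 (pr a).
Proof.
rewrite /rank1 -lock linfunE // => c x y; apply: (form_inj g_nondeg) => W.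
by rewrite !formE; ring.
Qed.

(** The tensor whose quartic form is the fourth power of [symp a]; see [quartic_veronese]. *)
Definition veronese a : bilEnd :=
  linfun (fun X => linfun (fun Y => g (rank1 a X) Y *: rank1 a)).

Lemma veroneseE a X Y : veronese a X Y = g (rank1 a X) Y *: rank1 a.
Proof.
have linY X' : linear (fun Y => g (rank1 a X') Y *: rank1 a).
  by move=> c x y; rewrite !formE scalerDl scalerA.
rewrite /veronese linfunE; first by rewrite linfunE.
move=> c x y; apply/lfunP => Y'.
by rewrite add_lfunE scale_lfunE !linfunE // lfunD lfunZ !formE scalerDl scalerA.
Qed.

Lemma rank1_spH a : spH g G (rank1 a).
Proof.
apply: (spHP GJ) => [X Y|b X].
  by rewrite !rank1E !formE ![g _ (pr a)]formC ![g _ (J1 _)]formC; ring.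
have JX y : g y (J b X) = - g (J b y) X by rewrite Jskew opprK.
apply: (form_inj g_nondeg) => W; rewrite !rank1E !JX !lfunE !formE.
by elim/ord3_ind: b {JX}; rewrite !JE ?J3_pr ?J2_pr ?formE ?J2_pr ?J3_pr; ring.
Qed.

Lemma rank1_pr a x : rank1 a (pr x) = w a x *: pr a.
Proof. by rewrite rank1E form_pr scale0r subr0. Qed.

Lemma symp_self a : w a a = 0.
Proof. by have := sympC a a; lra. Qed.

Lemma rank1_J b a X : rank1 a (J b X) = J b (rank1 a X).
Proof. exact: (spH_commute GJ b X (rank1_spH a)). Qed.

Lemma rank1_skew a : Defs.skew g (rank1 a).
Proof. by have [] := rank1_spH a. Qed.

Lemma rank1_rank1 a X : rank1 a (rank1 a X) = 0.
Proof.
rewrite [rank1 a X]rank1E !lfunE rank1_J rank1_pr symp_self scale0r lfun0.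
by rewrite !scaler0 subrr.
Qed.

Lemma veronese_curvature a : N (veronese a).
Proof.
split=> [X|X Y|X Y Z]; rewrite !veroneseE.
- by rewrite (skew_self _ (@rank1_skew a)) scale0r.
- apply: (spHP GJ) => [Z W|b Z]; rewrite !lfunE.
    by rewrite !formE (@rank1_skew a Z); ring.
  by rewrite rank1_J.
- apply: (form_inj g_nondeg) => W; rewrite !lfunE !rank1E !formE; ring.
Qed.

Lemma quartic_veronese a x y z u :
  S (veronese a) x y z u = w a x * w a y * w a z * w a u.
Proof.
have gw t : g (pr a) (J1 (pr t)) = - w a t by rewrite formC sympC opprK.
rewrite /quartic veroneseE lfunE !formE !rank1_pr !formE !gw; ring.
Qed.

Lemma act_form A T X Y Z W : Defs.skew g A -> g (act A T X Y Z) W =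
  - (g (T (A X) Y Z) W + g (T X (A Y) Z) W + g (T X Y (A Z)) W + g (T X Y Z) (A W)).
Proof. by move=> sA; rewrite actE !(bracketE, lfunE) !formE sA; ring. Qed.

Let act2_form A T X Y Z W : Defs.skew g A -> (forall x, A (A x) = 0) ->
  g (act A (act A T) X Y Z) W = 2 * (g (T (A X) (A Y) Z) W + g (T (A X) Y (A Z)) W
    + g (T (A X) Y Z) (A W) + g (T X (A Y) (A Z)) W + g (T X (A Y) Z) (A W)
    + g (T X Y (A Z)) (A W)).
Proof.
move=> sA AA; rewrite !(act_form, AA) // !(lfun0, zero_lfunE) !formE; ring.
Qed.

(* The square of A vanishes, so of the 4^4 terms of the fourth derivative of        *)
(* g(T(X, Y)Z, W) only the 4! terms with one A in each slot survive.                *)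
Lemma act4_veronese a T : curvature (Defs.skew g) T -> let A := rank1 a in
  act A (act A (act A (act A T))) = (24 * S T a a a a) *: veronese a.
Proof.
move=> cT A; have sA := @rank1_skew a; have AA := @rank1_rank1 a.
(* The image of A is spanned by [pr a] and [J1 (pr a)], and T is alternating. *)
have AE X Y Z W : g (T (A X) (A Y) Z) W =
    - g (A X) Y * g (T (pr a) (J1 (pr a)) Z) W.
  have [TX _ _] := cT; rewrite /A !rank1E !lfunE !TX (curv_swap cT (J1 _)).
  by rewrite !(lfunE, zero_lfunE) !formE; ring.
have AE' X Y Z W : g (T X Y (A Z)) (A W) =
    - g (A Z) W * g (T X Y (pr a)) (J1 (pr a)).
  by rewrite (curv_pair cT X Y (A Z)) AE -(curv_pair cT X Y).
apply/lfunP => X; apply/lfunP => Y; apply/lfunP => Z; apply: (form_inj g_nondeg) => W.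
rewrite !scale_lfunE veroneseE scale_lfunE !formE -/A.
rewrite !act2_form // !AA !(lfun0, zero_lfunE) !formE AE AE' /quartic; ring.
Qed.

Lemma quartic_sum I (r : seq I) (F : I -> bilEnd) x y z u :
  S (\sum_(i <- r) F i) x y z u = \sum_(i <- r) S (F i) x y z u.
Proof. by rewrite /quartic !sum_lfunE form_suml. Qed.

(* The complete polarization of the fourth power, up to a factor. *)
Definition polar_veronese a b c e : bilEnd :=
  veronese (a + b + c + e) - veronese (a + b + c - e) - veronese (a + b - c + e)
  + veronese (a + b - c - e) - veronese (a - b + c + e) + veronese (a - b + c - e)
  + veronese (a - b - c + e) - veronese (a - b - c - e).

(** Only the monomial odd in b, c and e survives the signs: 8 sign choices times 4! is 192. *)
Lemma quartic_polar a b c e x : S (polar_veronese a b c e) x x x x =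
  192 * (w a x * w b x * w c x * w e x).
Proof.
have D T T' : S (T + T') x x x x = S T x x x x + S T' x x x x.
  by rewrite -[T]scale1r quartic_lin mul1r scale1r.
have NS T : S (- T) x x x x = - S T x x x x by rewrite /quartic !lfunE formNl.
rewrite /polar_veronese !(D, NS) !quartic_veronese.
rewrite !(sympDl, sympNl); ring.
Qed.

(** The coordinates of [pr x] are themselves symplectic products, with the vectors - J1 d_i, so
    monomials in them are products of forms that [quartic_polar] handles. *)
Lemma quartic_coord T x y z u :
  S T x y z u = \sum_i w (- J1 (d i)) x * S T (v i) y z u.
Proof.
rewrite {1}/quartic -(pr_pr x) (dual_decomp g_nondeg (pr x)).
rewrite !(lfun_sum, sum_lfunE) form_suml.
apply: eq_bigr => i _; rewrite !lfunE formZl /quartic; congr (_ * _).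
by rewrite /symp !lfunN pr_J1 opprB formDl formNl form_pr subr0.
Qed.

(** Each monomial of the quartic of T is replaced by its polarized fourth powers. The index order l,
    i, k, j is that produced by the slot exchanges in [quartic_waring]. *)
Let waring_sum T : bilEnd := \sum_i \sum_j \sum_k \sum_l
  S T (v l) (v i) (v k) (v j) *:
    polar_veronese (- J1 (d i)) (- J1 (d j)) (- J1 (d k)) (- J1 (d l)).

Let quartic_waring T x : N T -> S (waring_sum T) x x x x = 192 * S T x x x x.
Proof.
move=> NT; rewrite /waring_sum quartic_sum quartic_coord mulr_sumr.
apply: eq_bigr => i _; rewrite quartic_sum (quartic12 NT) quartic_coord !mulr_sumr.
apply: eq_bigr => j _; rewrite quartic_sum (quartic13 NT) quartic_coord !mulr_sumr.
apply: eq_bigr => k _; rewrite quartic_sum (quartic34 NT) (quartic13 NT).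
rewrite quartic_coord !mulr_sumr.
apply: eq_bigr => l _; rewrite -[_ *: _]addr0 quartic_lin quartic_polar.
rewrite {2}/quartic !zero_lfunE formE; ring.
Qed.

(** * Nonzero submodules are everything *)

Section Submodule.
Variable U : set bilEnd.
Hypothesis U_sub : submodule (spG g G) N U.

Let UN : U `<=` N. Proof. by case: U_sub. Qed.
Let U0 : U 0. Proof. by case: U_sub. Qed.
Let U_lin c T T' : U T -> U T' -> U (c *: T + T').
Proof. by case: U_sub => _ _ + _; exact. Qed.

Let U_scale c T : U T -> U (c *: T).
Proof. by move=> UT; rewrite -[_ *: _]addr0; exact: U_lin. Qed.

Let U_sum I (r : seq I) (F : I -> bilEnd) :
  (forall i, U (F i)) -> U (\sum_(i <- r) F i).
Proof.
move=> UF; elim/big_rec: _ => // i T _ UT.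
by rewrite -[F i]scale1r; exact: U_lin.
Qed.

Let veronese_mem_quartic T a : U T -> S T a a a a != 0 -> U (veronese a).
Proof.
move=> UT Ta; have c0 : 24 * S T a a a a != 0 by rewrite mulf_neq0 // pnatr_eq0.
have UA T' : U T' -> U (act (rank1 a) T').
  by case: U_sub => _ _ _; apply; exact/spH_spG/rank1_spH.
rewrite -[veronese a](scalerK c0); apply: U_scale; rewrite -act4_veronese.
  exact: UA (UA _ (UA _ (UA _ UT))).
exact/(curvatureS (@spG_skew _ _ G g))/(curvatureS (@spH_spG _ _ G g))/UN.
Qed.

Let rank1_eq0 a : pr a = 0 -> rank1 a = 0.
Proof.
move=> a0; apply/lfunP => X.
by rewrite rank1E a0 lfun0 !scaler0 subrr zero_lfunE.
Qed.

Lemma submodule_veronese T a b : U T -> S T a a a a != 0 -> U (veronese b).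
Proof.
move=> UT Ta; have Ua := veronese_mem_quartic UT Ta.
have step x y : U (veronese x) -> w x y != 0 -> U (veronese y).
  move=> Ux xy; apply: (veronese_mem_quartic Ux).
  by rewrite quartic_veronese !mulf_neq0.
have [b0|b0] := eqVneq (pr b) 0.
  suff -> : veronese b = 0 by [].
  apply/lfunP => X; apply/lfunP => Y.
  by rewrite veroneseE rank1_eq0 // scaler0 !zero_lfunE.
have a0 : pr a != 0.
  by apply: contra_neq Ta => a0; rewrite /quartic a0 !(lfun0, zero_lfunE) form0l.
have [c [ac bc]] := symp_neq0_common a0 b0.
by apply: (step c); [apply: (step a)|rewrite sympC oppr_eq0].
Qed.

Lemma submodule_full T : U T -> T != 0 -> U = N.
Proof.
move=> UT T0; have [a Ta] : exists a, S T a a a a != 0.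
  apply: contrapT => nS; case/eqP: T0; apply: (quartic_eq0 (UN UT)) => x.
  by apply/eqP/negPn/negP => Sx; apply: nS; exists x.
have UV b : U (veronese b) by exact: submodule_veronese UT Ta.
have UB T1 T2 : U T1 -> U T2 -> U (T1 - T2).
  by move=> U1 U2; rewrite addrC -scaleN1r; exact: U_lin.
have UD T1 T2 : U T1 -> U T2 -> U (T1 + T2).
  by move=> U1 U2; rewrite -[T1]scale1r; exact: U_lin.
have Up b c e f : U (polar_veronese b c e f).
  apply: (UB _ _ (UD _ _ (UD _ _ (UB _ _ (UD _ _ (UB _ _ (UB _ _ _ _) _) _) _) _) _) _);
  exact: UV.
apply/seteqP; split=> // T' NT'.
have UW : U (waring_sum T').
  by do 4![apply: U_sum => ?]; exact: U_scale.
have ND := UN UW.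
(* The difference has zero quartic form on the diagonal, so it vanishes by [quartic_eq0]. *)
rewrite -[T'](subrK (192^-1 *: waring_sum T')) addrC; apply: U_lin => //.
rewrite [T' - _](quartic_eq0 (T := T' - _)) //.
  by rewrite addrC -scaleNr; apply: curvature_lin => //; exact: spH_lin.
move=> x; rewrite addrC -scaleNr quartic_lin quartic_waring //.
by rewrite mulrA mulNr mulVf ?pnatr_eq0 // mulN1r addNr.
Qed.

End Submodule.

Lemma spH_irreducible : \dim {:V} != 0%N ->
  irreducible_submodule (spG g G) (curvature (spG g G)) N.
Proof.
move=> V0; split; first exact: spH_submodule.
  (* If [pr] were zero, [pr_J1] would force every vector to be zero. *)
  have [x x0] : exists x, pr x != 0.
    apply: contrapT => npr; have pr0 x : pr x = 0.
      by apply/eqP/negPn/negP => prx; apply: npr; exists x.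
    case/negP: V0; rewrite dimv_eq0 -subv0; apply/subvP => x _; rewrite memv0.
    by have /eqP := pr_J1 x; rewrite !pr0 lfun0 eq_sym sub0r oppr_eq0.
  exists (veronese x); first exact: veronese_curvature.
  have [y xy] := symp_neq0 x0; apply/eqP => vx0.
  have := quartic_veronese x y y y y; rewrite vx0 /quartic !zero_lfunE form0l.
  by move/esym/eqP; rewrite !mulf_eq0 (negPf xy).
move=> U U_sub; have [[T [UT T0]]|nU] := pselect (exists T, U T /\ T != 0).
  by right; exact: submodule_full UT T0.
left; apply/seteqP; split=> [T UT|_ ->]; last by case: U_sub.
by apply/eqP/negPn/negP => T0; apply: nU; exists T.
Qed.

End Irreducibility.

Theorem theorem4p2 (R : realType) (n : nat) (V : vectType R)
    (g : {symmetric V}) (G : {vspace 'End(V)}) (J : 'I_3 -> 'End(V))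
    (hn : (2 <= n)%N)
    (hV : \dim {:V} = (4 * n)%N)
    (hg : nondegenerate g)
    (hG : para_quaternionic G)
    (hGg : hermitian_for g G)
    (hJ : corresponding G J) :
  (forall T, curvature (spG g G) T ->
     forall X Y, Ric T X Y = scal g T / (4 * n)%:R * g X Y)
  /\
  [/\ curvature (spG g G)
        = [set c *: R_HP g J + T | c in [set: R] & T in curvature (spH g G)],
      curvature (spH g G) `<=` Weyl G &
      irreducible_submodule (spG g G) (curvature (spG g G))
        (curvature (spH g G))].
Proof.
have [Jpara GJ] := hJ.
(* [hermitian_for] provides some skew adapted basis J'; the given J consists of linear combinations
   of it. *)
have Jskew a : Defs.skew g (J a).
  have [J' [[_ GJ'] skJ']] := hGg.
  have [b Jb] := span_J GJ' (mem_J GJ a).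
  move=> X Y; rewrite !Jb !(formDl, formDr, formZl, formZr) !skJ'; ring.
split; first exact: einstein hg Jpara GJ Jskew hV hn.
split.
- exact: curvature_spG_decomp hg Jpara GJ Jskew hV hn.
- exact: curvature_spH_Weyl hg Jpara GJ Jskew hV hn.
- apply: (spH_irreducible hg Jpara GJ Jskew).
  by rewrite hV muln_eq0 /= -lt0n ltnW.
Qed.
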